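(* For every integer $n\ge0$, the type $R_I$ $q$-Lommel polynomials have the explicit formula $$r_n(x;c,q)=\frac{1}{(c^{-1};q^{-1})_n}\sum_{k=0}^n\sum_{a=0}^{n-k}\left(-\frac xc\right)^kq^{-\binom k2}\begin{bmatrix}k+a\\ a\end{bmatrix}_{q^{-1}}c^{-a}\begin{bmatrix}n-a\\ k\end{bmatrix}_{q^{-1}}x^{n-k-a}.$$
   Context: $c,q$ are indeterminates. $(a;p)_n=\prod_{i=0}^{n-1}(1-ap^i)$, and $\begin{bmatrix}N\\ k\end{bmatrix}_{p}=\frac{(p;p)_N}{(p;p)_k(p;p)_{N-k}}$ is the Gaussian binomial coefficient in base $p$; here $p=q^{-1}$. The type $R_I$ $q$-Lommel polynomials are defined by $r_{-1}(x;c,q)=0$, $r_0(x;c,q)=1$, and $r_{n+1}(x;c,q)=(x-b_n)r_n(x;c,q)-x\,a_nr_{n-1}(x;c,q)$ for $n\ge0$, where $b_n=\dfrac{q^n}{1-cq^n}$ and $a_n=\dfrac{cq^{2n-1}}{(1-cq^{n-1})(1-cq^n)}$. *)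

(* Defs.v *)
From HB Require Import structures.
From mathcomp Require Import all_boot all_order all_algebra.

Set Implicit Arguments.
Unset Strict Implicit.
Unset Printing Implicit Defensive.

Import GRing.Theory.
Local Open Scope ring_scope.

(* The field K(c, q) of rational functions in two independent indeterminates
   over K, as the fraction field of K[c][q]. *)
Definition ratfun_cq (K : fieldType) : fieldType := {fraction {poly {poly K}}}.

Definition indet_c (K : fieldType) : ratfun_cq K :=
  @tofrac {poly {poly K}} ('X%:P).
Definition indet_q (K : fieldType) : ratfun_cq K :=
  @tofrac {poly {poly K}} 'X.

Section QLommel.
Variable F : fieldType.

Definition qpoch (a p : F) (n : nat) : F := \prod_(i < n) (1 - a * p ^+ i).

(* Meaningful for k <= N only: N - k is truncated. *)
Definition gauss_binom (p : F) (N k : nat) : F :=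
  qpoch p p N / (qpoch p p k * qpoch p p (N - k)).

Definition lommel_b (c q : F) (n : nat) : F := q ^+ n / (1 - c * q ^+ n).

(* Integer exponents: for n = 0 the powers of q are q^(-1). *)
Definition lommel_a (c q : F) (n : nat) : F :=
  c * q ^ ((2 * n)%N%:Z - 1) /
    ((1 - c * q ^ (n%:Z - 1)) * (1 - c * q ^+ n)).

(* Index shifted by one: [lommel_shift c q m] is r_{m-1}, so that the sequence
   starts at r_{-1} = 0. *)
Fixpoint lommel_shift (c q : F) (m : nat) : {poly F} :=
  match m with
  | 0 => 0
  | m'.+1 =>
    match m' with
    | 0 => 1
    | n.+1 => ('X - (lommel_b c q n)%:P) * lommel_shift c q m'
              - 'X * (lommel_a c q n)%:P * lommel_shift c q n
    end
  end.

Definition lommel (c q : F) (n : nat) : {poly F} := lommel_shift c q n.+1.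

Lemma lommel0 (c q : F) : lommel c q 0 = 1.
Proof. by []. Qed.

Lemma lommel1 (c q : F) :
  lommel c q 1 = ('X - (lommel_b c q 0)%:P) * lommel c q 0
                 - 'X * (lommel_a c q 0)%:P * 0.
Proof. by []. Qed.

Lemma lommelSS (c q : F) (n : nat) :
  lommel c q n.+2 =
    ('X - (lommel_b c q n.+1)%:P) * lommel c q n.+1
    - 'X * (lommel_a c q n.+1)%:P * lommel c q n.
Proof. by []. Qed.

End QLommel.

(* Main.v *)
Require Import Defs.
From HB Require Import structures.
From mathcomp Require Import all_boot all_order all_algebra.
From mathcomp Require Import ring zify.
Import GRing.Theory.
Local Open Scope ring_scope.

(** Put [p = q^-1] and [d = c^-1].  In these variables the coefficients of the
recurrence become [b_n = - d / (1 - d p^n)] and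
[a_n = d / ((1 - d p^(n-1)) (1 - d p^n))], so that [S_n = (d; p)_n r_n]
satisfies a recurrence free of denominators:
  [S_(n+1) = ((1 - d p^n) x + d) S_n - d x S_(n-1)].
The right-hand side of the explicit formula, sorted by powers of [x], is
[\sum_(m + a = n) d^a P(m, a) x^m] with
  [P(m, a) = \sum_k (-d)^k p^(k choose 2) [k + a, a] [m, k]],
where brackets are Gaussian binomials in base [p].  Comparing coefficients of
[x^(m+1)], that expression satisfies the same recurrence as [S_n] as soon as
  [P(m+1, a+1) = (1 - d p^(m+a+1)) P(m, a+1) + P(m+1, a) - P(m, a)]
([inner_sumSS]), together with its degenerate forms on the boundary [m = 0] or
[a = 0].  This identity holds term by term in powers of [d]: one of the two
q-Pascal rules, applied to [[m+1, k+1]], turns the differences in [m] into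
multiples of [[m, k]] ([inner_termB]), and what remains is the other q-Pascal
rule for [[k + a + 2, a + 1]].

The argument is valid in every field in which the denominators do not vanish
([lommel_explicit]); two independent indeterminates satisfy this because
neither [q^i] with [i > 0] nor [c q^i] is equal to 1. *)

(** * Gaussian binomials and the q-Pascal rules *)

Section GaussBinomial.
Variables (F : fieldType) (p : F).
Hypothesis p_not_root1 : forall i, (0 < i)%N -> p ^+ i != 1.

Lemma qpochS (a : F) (n : nat) : qpoch a p n.+1 = qpoch a p n * (1 - a * p ^+ n).
Proof. by rewrite /qpoch big_ord_recr. Qed.

Lemma one_sub_exp_neq0 (i : nat) : 1 - p * p ^+ i != 0.
Proof. by rewrite -exprS subr_eq0 eq_sym p_not_root1. Qed.

Lemma qpoch_neq0 (n : nat) : qpoch p p n != 0.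
Proof. by apply/prodf_neq0 => i _; exact: one_sub_exp_neq0. Qed.

(** Vanishing above the diagonal makes the q-Pascal rules hold without
restriction, so that sums over [k] can be lengthened freely. *)
Definition gbin (N k : nat) : F := if (k <= N)%N then gauss_binom p N k else 0.

Lemma gbin_gauss (N k : nat) : (k <= N)%N -> gbin N k = gauss_binom p N k.
Proof. by rewrite /gbin => ->. Qed.

Lemma gbin_small (N k : nat) : (N < k)%N -> gbin N k = 0.
Proof. by move=> ltNk; rewrite /gbin leqNgt ltNk. Qed.

Lemma gbin0 (N : nat) : gbin N 0 = 1.
Proof.
by rewrite /gbin /gauss_binom subn0 {2}/qpoch big_ord0 mul1r divff ?qpoch_neq0.
Qed.

Lemma gbinn (N : nat) : gbin N N = 1.
Proof.
rewrite /gbin leqnn /gauss_binom subnn {3}/qpoch big_ord0 mulr1.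
by rewrite divff ?qpoch_neq0.
Qed.

(** With [i = k + 1] and [j = N - k], both rules come from splitting
[1 - p^(i+j)], as
[(1 - p^j) + p^j (1 - p^i)] or as [(1 - p^i) + p^i (1 - p^j)], in the top
factor of the numerator. *)
Lemma gbin_pascal (N k : nat) :
  gbin N.+1 k.+1 = gbin N k.+1 + p ^+ (N - k) * gbin N k
  /\ gbin N.+1 k.+1 = p ^+ k.+1 * gbin N k.+1 + gbin N k.
Proof.
have [ltNk | ltkN | ->] := ltngtP N k.
- by rewrite !gbin_small ?mulr0 ?addr0 //; lia.
- have [j defN] : exists j, N = (k + j.+1)%N by exists (N - k).-1; lia.
  rewrite !gbin_gauss; try lia; rewrite /gauss_binom.
  have -> : (N.+1 - k.+1 = j.+1)%N by lia.
  have -> : (N - k.+1 = j)%N by lia.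
  have -> : (N - k = j.+1)%N by lia.
  rewrite !qpochS defN exprD !exprS.
  have := one_sub_exp_neq0 k; have := one_sub_exp_neq0 j.
  have := qpoch_neq0 k; have := qpoch_neq0 j.
  move: (qpoch p p (k + j.+1)) (qpoch p p k) (qpoch p p j) => A B C.
  move: (p ^+ k) (p ^+ j) => x y nzC nzB nzy nzx.
  by split; field; rewrite nzC nzB nzy nzx.
- by rewrite !gbinn gbin_small // subnn expr0 mulr0 mulr1 add0r.
Qed.

(** * The coefficients of the explicit formula *)

Variable d : F.

Definition inner_term (m a k : nat) : F :=
  (- d) ^+ k * p ^+ 'C(k, 2) * gbin (k + a) a * gbin m k.

Definition inner_sum (m a : nat) : F := \sum_(k < m.+1) inner_term m a k.

Lemma inner_term0 (m a : nat) : inner_term m a 0 = 1.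
Proof. by rewrite /inner_term add0n gbinn gbin0 !mulr1. Qed.

(** The factor [p^(m-k)] of the q-Pascal rule combines with
[p^(k+1 choose 2) = p^(k choose 2) p^k] into a power independent of [k]. *)
Lemma inner_termB (m a k : nat) :
  inner_term m.+1 a k.+1 - inner_term m a k.+1
  = - (d * p ^+ m) * ((- d) ^+ k * p ^+ 'C(k, 2) * gbin (k + a).+1 a * gbin m k).
Proof.
rewrite /inner_term -mulrBr (gbin_pascal m k).1 [X in _ * X]addrC addKr.
have [lemk | ltmk] := leqP k m; last by rewrite (gbin_small m k) // !mulr0.
have -> : p ^+ m = p ^+ k * p ^+ (m - k) by rewrite -exprD subnKC.
rewrite binS bin1 exprD exprS addSn; ring.
Qed.

(** The differences in [m] on both sides are given by [inner_termB] and involve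
[a] only through the binomials [[k + a + 2, a + 1]] and [[k + a + 1, a]], which
the q-Pascal rule in [a] relates. *)
Lemma inner_termSS (m a k : nat) :
  inner_term m.+1 a.+1 k.+1
  = inner_term m a.+1 k.+1 - d * p ^+ (m + a).+1 * inner_term m a.+1 k
    + (inner_term m.+1 a k.+1 - inner_term m a k.+1).
Proof.
rewrite -[LHS](subrK (inner_term m a.+1 k.+1)) !inner_termB.
rewrite (gbin_pascal (k + a.+1) a).2 {3}/inner_term addnS !exprS exprD; ring.
Qed.

(** The form that [inner_termSS] takes for [a = 0] when the terms of index [-1]
are read as zero. *)
Lemma inner_term_S0 (m k : nat) :
  inner_term m.+1 0 k.+1
  = inner_term m 0 k.+1 - d * p ^+ m * inner_term m 0 k.
Proof.
rewrite -[LHS](subrK (inner_term m 0 k.+1)) inner_termB addrC.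
by rewrite /inner_term !gbin0 mulNr.
Qed.

(** The last summand vanishes; it is there so that [inner_sum m a] and
[inner_sum m.+1 a] run over the same range of [k]. *)
Lemma inner_sum_widen (m a : nat) :
  inner_sum m a = 1 + \sum_(k < m.+1) inner_term m a k.+1.
Proof.
rewrite -(inner_term0 m a) -(big_ord_recl _ (fun k : 'I__ => inner_term m a k)).
rewrite big_ord_recr /= [X in _ = _ + X](_ : _ = 0) ?addr0 //.
by rewrite /inner_term (gbin_small m) ?mulr0.
Qed.

Lemma inner_sumS (m a : nat) :
  inner_sum m.+1 a = 1 + \sum_(k < m.+1) inner_term m.+1 a k.+1.
Proof. by rewrite /inner_sum big_ord_recl /= inner_term0. Qed.

Lemma inner_sumSS (m a : nat) :
  inner_sum m.+1 a.+1
  = (1 - d * p ^+ (m + a).+1) * inner_sum m a.+1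
    + inner_sum m.+1 a - inner_sum m a.
Proof.
rewrite !inner_sumS; under eq_bigr do rewrite inner_termSS.
rewrite !big_split /= !sumrN -big_distrr /= mulrBl mul1r.
rewrite {1}(inner_sum_widen m a.+1) (inner_sum_widen m a) /inner_sum; ring.
Qed.

Lemma inner_sum_S0 (m : nat) :
  inner_sum m.+1 0 = (1 - d * p ^+ m) * inner_sum m 0.
Proof.
rewrite inner_sumS; under eq_bigr do rewrite inner_term_S0.
rewrite big_split /= sumrN -big_distrr /= mulrBl mul1r.
by rewrite {1}(inner_sum_widen m 0) addrA.
Qed.

Lemma inner_sum_nat (m a N : nat) :
  (m < N)%N -> \sum_(0 <= k < N) inner_term m a k = inner_sum m a.
Proof.
move=> ltmN; rewrite (@big_cat_nat _ _ _ m.+1) //= big_mkord.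
rewrite [X in _ + X]big_nat [X in _ + X]big1 ?addr0 // => k /andP[ltmk _].
by rewrite /inner_term (gbin_small m) ?mulr0.
Qed.

Lemma inner_sum0 (a : nat) : inner_sum 0 a = 1.
Proof. by rewrite /inner_sum big_ord1 inner_term0. Qed.

(** * The recurrence satisfied by the explicit formula *)

(** The double sum of the explicit formula, sorted by powers of ['X]: the
coefficient of ['X^m] collects the terms with [a = n - m]. *)
Definition scaled_lommel (n : nat) : {poly F} :=
  \poly_(m < n.+1) (d ^+ (n - m) * inner_sum m (n - m)).

Lemma scaled_lommel0 : scaled_lommel 0 = 1.
Proof.
apply/polyP => -[|m]; rewrite coef_poly coef1 //=.
by rewrite inner_sum0 mulr1.
Qed.

Lemma scaled_lommel1 : scaled_lommel 1 = (1 - d) *: 'X + d%:P.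
Proof.
apply/polyP => -[|[|m]]; rewrite coef_poly !coefE /= ?mulr0 ?mulr1 ?add0r ?addr0 //.
  by rewrite inner_sum0 mulr1.
by rewrite inner_sum_S0 inner_sum0 expr0 !mulr1 mul1r.
Qed.

(** In degree [m+1], this is [inner_sumSS] if [m <= n], the boundary case
[inner_sum_S0] if [m = n+1], and trivial above. *)
Lemma scaled_lommelSS (n : nat) :
  scaled_lommel n.+2
  = ((1 - d * p ^+ n.+1) *: 'X + d%:P) * scaled_lommel n.+1
    - d *: ('X * scaled_lommel n).
Proof.
apply/polyP => -[|m].
  rewrite mulrDl -scalerAl coefB coefD !coefZ !coefXM coefCM /= !coef_poly /=.
  by rewrite !inner_sum0 !mulr1 !mulr0 add0r subr0 subn0 exprS.
rewrite mulrDl -scalerAl coefB coefD !coefZ !coefXM coefCM /= !coef_poly !ltnS.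
rewrite !subSS.
have [ltnm | lemn | ->] := ltngtP m n.+1.
- rewrite -ltnS ltnm.
  have [a defn] : exists a, n = (m + a)%N by exists (n - m)%N; lia.
  have -> : (n.+1 - m = a.+1)%N by lia.
  have -> : (n - m = a)%N by lia.
  rewrite inner_sumSS defn exprS; ring.
- by rewrite leqNgt (ltnW lemn) /= !mulr0 addr0 subr0.
- by rewrite ltnn !mulr0 subr0 addr0 subnn inner_sum_S0 !expr0 !mul1r.
Qed.

End GaussBinomial.

(** * From the recurrence to the explicit formula *)

Section ExplicitFormula.
Variables (F : fieldType) (c q : F).
Hypotheses (c_neq0 : c != 0) (q_neq0 : q != 0).
Hypothesis q_not_root1 : forall i, (0 < i)%N -> q ^+ i != 1.
Hypothesis cq_neq1 : forall i, c * q ^+ i != 1.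

Lemma expV_neq1 (i : nat) : (0 < i)%N -> q^-1 ^+ i != 1.
Proof. by move=> i_gt0; rewrite exprVn invr_eq1 q_not_root1. Qed.

Lemma one_sub_cq_neq0 (i : nat) : 1 - c * q ^+ i != 0.
Proof. by rewrite subr_eq0 eq_sym. Qed.

Lemma one_sub_cqV_neq0 (i : nat) : 1 - c^-1 * q^-1 ^+ i != 0.
Proof. by rewrite subr_eq0 eq_sym exprVn -invfM invr_eq1. Qed.

Lemma lommel_bE (n : nat) :
  lommel_b c q n = - (c^-1 / (1 - c^-1 * q^-1 ^+ n)).
Proof.
have := one_sub_cq_neq0 n.
rewrite /lommel_b exprVn; have := expf_neq0 n q_neq0.
move: (q ^+ n) => x nzx nz1; field.
by rewrite nzx c_neq0 -(opprB 1) oppr_eq0 nz1.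
Qed.

Lemma lommel_aSE (n : nat) :
  lommel_a c q n.+1
  = c^-1 / ((1 - c^-1 * q^-1 ^+ n) * (1 - c^-1 * q^-1 ^+ n.+1)).
Proof.
have := one_sub_cq_neq0 n; have := one_sub_cq_neq0 n.+1.
rewrite /lommel_a.
have -> : (2 * n.+1)%N%:Z - 1 = (n + n).+1%:Z by lia.
have -> : n.+1%:Z - 1 = n%:Z by lia.
rewrite -!exprnP !exprVn !exprS exprD; have := expf_neq0 n q_neq0.
move: (q ^+ n) => x nzx nz1 nz2; field.
by rewrite nzx q_neq0 c_neq0 -2!(opprB 1) !oppr_eq0 nz1 nz2.
Qed.

Lemma qpochV_neq0 (n : nat) : qpoch c^-1 q^-1 n != 0.
Proof. by apply/prodf_neq0 => i _; exact: one_sub_cqV_neq0. Qed.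

(** Both sides satisfy the same second-order recurrence; the factor [(d; p)_n]
cancels the denominators of [a_n] and [b_n]. *)
Lemma scaled_lommelE (n : nat) :
  scaled_lommel F q^-1 c^-1 n = qpoch c^-1 q^-1 n *: lommel c q n.
Proof.
have qpoch1 : qpoch c^-1 q^-1 1 = 1 - c^-1.
  by rewrite /qpoch big_ord1 expr0 mulr1.
suff [] : scaled_lommel F q^-1 c^-1 n = qpoch c^-1 q^-1 n *: lommel c q n
  /\ scaled_lommel F q^-1 c^-1 n.+1 = qpoch c^-1 q^-1 n.+1 *: lommel c q n.+1.
  by [].
elim: n => [|n [IHn IHn1]].
  rewrite scaled_lommel0 ?scaled_lommel1; try exact: expV_neq1.
  split; first by rewrite /qpoch big_ord0 scale1r.
  rewrite qpoch1 lommel1 lommel0 mulr1 mulr0 subr0 lommel_bE expr0 mulr1.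
  rewrite polyCN opprK -!mul_polyC mulrDr -polyCM (mulrC _ (_ / _)) divfK //.
  by have := one_sub_cqV_neq0 0; rewrite expr0 mulr1.
split=> //; rewrite scaled_lommelSS; last exact: expV_neq1.
rewrite IHn IHn1 lommelSS lommel_bE lommel_aSE !qpochS.
have := one_sub_cqV_neq0 n; have := one_sub_cqV_neq0 n.+1.
move: (lommel c q n) (lommel c q n.+1) (qpoch _ _ n) => r0 r1 Q.
move: (1 - _ * _ ^+ n) (1 - _ * _ ^+ n.+1) => u v nzv nzu.
rewrite -!mul_polyC polyCN.
(* The two occurrences of d in the recurrence stand for different coefficients,
   d = v * (- b_(n+1)) and d = u * v * a_(n+1). *)
have d_eq1 : c^-1%:P = v%:P * (c^-1 / v)%:P by rewrite -polyCM mulrC divfK.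
have d_eq2 : c^-1%:P = (u * v)%:P * (c^-1 / (u * v))%:P.
  by rewrite -polyCM mulrC divfK ?mulf_neq0.
rewrite {1}d_eq1 [X in _ - X * _]d_eq2 !polyCM; ring.
Qed.

Lemma lommel_explicit (n : nat) :
  lommel c q n =
    (qpoch c^-1 q^-1 n)^-1 *:
      \sum_(0 <= k < n.+1) \sum_(0 <= a < (n - k).+1)
        (- (c^-1 *: 'X)) ^+ k * (q ^- 'C(k, 2))%:P
        * (gauss_binom q^-1 (k + a) a)%:P * (c ^- a)%:P
        * (gauss_binom q^-1 (n - a) k)%:P * 'X^(n - k - a).
Proof.
rewrite -[LHS]scale1r -(mulVf (qpochV_neq0 n)) -scalerA -scaled_lommelE.
congr (_ *: _); rewrite /scaled_lommel poly_def.
(* Since [n - a, k] = 0 for a > n - k, the triangle of summation can be completed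
   to a square, on which the two sums commute. *)
transitivity (\sum_(0 <= k < n.+1) \sum_(0 <= a < n.+1)
    (c^-1 ^+ a * inner_term F q^-1 c^-1 (n - a) a k) *: 'X^(n - a)).
  rewrite exchange_big /= big_mkord (reindex_inj rev_ord_inj) /=.
  apply: eq_bigr => a _; rewrite subSS (subKn (leq_ord a)) -scaler_suml.
  by rewrite -big_distrr /= inner_sum_nat // ltnS leq_subr.
apply: eq_big_nat => k /andP[_ lekn].
rewrite (@big_cat_nat _ _ _ (n - k).+1) ?ltnS ?leq_subr //=.
rewrite [X in _ + X]big_nat [X in _ + X]big1 ?addr0; last first.
  move=> a /andP[ltka ltan].
  by rewrite /inner_term (gbin_small _ _ (n - a)) ?mulr0 ?scale0r //; lia.
apply: eq_big_nat => a /andP[_ leak].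
rewrite /inner_term !gbin_gauss; try lia.
have -> : (n - a = k + (n - k - a))%N by lia.
rewrite exprD -scaleNr exprZn -!mul_polyC !exprVn !polyCM; ring.
Qed.

End ExplicitFormula.

(** * Two independent indeterminates *)

Theorem theorem4p11 (K : fieldType) (n : nat) :
  let c : ratfun_cq K := indet_c K in
  let q : ratfun_cq K := indet_q K in
  lommel c q n =
    (qpoch c^-1 q^-1 n)^-1 *:
      \sum_(0 <= k < n.+1) \sum_(0 <= a < (n - k).+1)
        (- (c^-1 *: 'X)) ^+ k * (q ^- 'C(k, 2))%:P
        * (gauss_binom q^-1 (k + a) a)%:P * (c ^- a)%:P
        * (gauss_binom q^-1 (n - a) k)%:P * 'X^(n - k - a).
Proof.
move=> c q; apply: lommel_explicit.
- by rewrite tofrac_eq0 polyC_eq0 polyX_eq0.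
- by rewrite tofrac_eq0 polyX_eq0.
- move=> i i_gt0; rewrite -rmorphXn -tofrac1 tofrac_eq.
  apply/eqP => /(congr1 (size : {poly {poly K}} -> nat)).
  by rewrite size_polyXn size_poly1; lia.
- move=> i; rewrite -rmorphXn -rmorphM -tofrac1 tofrac_eq.
  (* Setting q = 1 reduces the claim to c != 1. *)
  apply/eqP => /(congr1 (fun P : {poly {poly K}} => P.[1])).
  rewrite hornerM hornerC hornerXn expr1n mulr1 hornerC =>
    /(congr1 (size : {poly K} -> nat)).
  by rewrite size_polyX size_poly1.
Qed.
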